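(* Let $p>0$, $p\neq1$, let $D\subset\mathbb{R}^2$ be a bounded simply connected domain, and let $u\colon D\to\mathbb{R}$ be a solution in $D$ of $$\frac{\partial^4 u}{\partial y^4}+(p^2+1)\frac{\partial^4 u}{\partial x^2\partial y^2}+p^2\frac{\partial^4 u}{\partial x^4}=0 .$$ Then there exists a monogenic function $\Phi_u\colon D_\zeta\to\mathbb{B}_0$ such that $\mathrm{U}_1[\Phi_u(\zeta)]=u(x,y)$ for all $\zeta=xe_1+ye_2\in D_\zeta$.
   Context: $\mathbb{B}_0$ is the commutative associative two-dimensional algebra over $\mathbb{C}$ with unit $e$ and basis $(e,\omega)$, $\omega^2=e$. It has the orthogonal idempotents $\mathcal{I}_1=\frac12(e+\omega)$, $\mathcal{I}_2=\frac12(e-\omega)$, with $\mathcal{I}_1\mathcal{I}_2=0$, $\mathcal{I}_1+\mathcal{I}_2=e$. Fix $p>0$, $p\neq1$, and the $\mathbb{C}$-basis of $\mathbb{B}_0$ $$e_1=e,\qquad e_2=i(\mathcal{I}_1+p\,\mathcal{I}_2),$$ whose multiplication table is $e_1e_2=e_2$, $e_2^2=p\,e_1+i(p+1)e_2$. Let $\mu_{e_1,e_2}=\{xe_1+ye_2: x,y\in\mathbb{R}\}$; every nonzero element of $\mu_{e_1,e_2}$ is invertible in $\mathbb{B}_0$. For a domain $D\subset\mathbb{R}^2$ put $D_\zeta=\{\zeta=xe_1+ye_2:(x,y)\in D\}$. A function $\Phi\colon D_\zeta\to\mathbb{B}_0$ is monogenic in $D_\zeta$ if at every $\zeta\in D_\zeta$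 the limit $$\Phi'(\zeta)=\lim_{h\to0,\ h\in\mu_{e_1,e_2}}(\Phi(\zeta+h)-\Phi(\zeta))h^{-1}$$ exists. Every $\Phi\colon D_\zeta\to\mathbb{B}_0$ is written uniquely as $\Phi(\zeta)=U_1(x,y)e_1+U_2(x,y)\,ie_1+U_3(x,y)e_2+U_4(x,y)\,ie_2$ with real-valued $U_k\colon D\to\mathbb{R}$, $\zeta=xe_1+ye_2$, and $\mathrm{U}_k[\Phi]:=U_k$. Solutions of the differential equation are classical: real-valued functions with continuous partial derivatives up to order four. *)

(* Defs.v *)
From Stdlib Require Import Reals Lra.
From Coquelicot Require Import Coquelicot.

Open Scope R_scope.

(** The pair (a, b) stands for [a e + b omega].  As a normed space B0 is C x C. *)
Definition B0 : NormedModule C_AbsRing :=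
  prod_NormedModule C_AbsRing C_NormedModule C_NormedModule.

Definition B0e : B0 := (RtoC 1, RtoC 0).
Definition B0omega : B0 := (RtoC 0, RtoC 1).

Definition B0mul (v w : B0) : B0 :=
  ((fst v * fst w + snd v * snd w)%C, (fst v * snd w + snd v * fst w)%C).

(** [a e + b omega] is invertible iff [a^2 - b^2 <> 0] (see [B0mul_inv] and
    [B0_invertible]); the value at non-invertible elements is irrelevant. *)
Definition B0inv (w : B0) : B0 :=
  let d := (fst w * fst w - snd w * snd w)%C in
  ((fst w / d)%C, (- snd w / d)%C).

Definition I1 : B0 := scal (RtoC (1 / 2)) (plus B0e B0omega).
Definition I2 : B0 := scal (RtoC (1 / 2)) (minus B0e B0omega).

Definition e1 : B0 := B0e.
Definition e2 (p : R) : B0 := scal Ci (plus I1 (scal (RtoC p) I2)).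

Definition zeta (p x y : R) : B0 :=
  plus (scal (RtoC x) e1) (scal (RtoC y) (e2 p)).

Definition mu (p : R) (h : B0) : Prop := exists x y : R, h = zeta p x y.

Definition Dzeta (p : R) (D : R * R -> Prop) (z : B0) : Prop :=
  exists x y : R, D (x, y) /\ z = zeta p x y.

(** Coordinates in the C-basis (e1, e2) for [p <> 1]: since
    [e2 = i (1 + p)/2 e + i (1 - p)/2 omega], the element [a e + b omega] is
    [coord1 e1 + coord2 e2]; see [U_decomposition] and [U_unique]. *)
Definition coord2 (p : R) (w : B0) : C :=
  (snd w / (Ci * RtoC ((1 - p) / 2)))%C.
Definition coord1 (p : R) (w : B0) : C :=
  (fst w - coord2 p w * (Ci * RtoC ((1 + p) / 2)))%C.

Definition U1 (p : R) (w : B0) : R := Re (coord1 p w).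
Definition U2 (p : R) (w : B0) : R := Im (coord1 p w).
Definition U3 (p : R) (w : B0) : R := Re (coord2 p w).
Definition U4 (p : R) (w : B0) : R := Im (coord2 p w).

Definition comb (p u1 u2 u3 u4 : R) : B0 :=
  plus (plus (scal (RtoC u1) e1) (scal (RtoC u2) (scal Ci e1)))
       (plus (scal (RtoC u3) (e2 p)) (scal (RtoC u4) (scal Ci (e2 p)))).

Definition is_monogenic_derive (p : R) (Phi : B0 -> B0) (z l : B0) : Prop :=
  filterlim (fun h : B0 => B0mul (minus (Phi (plus z h)) (Phi z)) (B0inv h))
    (within (fun h : B0 => mu p h /\ h <> zero) (locally (zero : B0)))
    (locally l).

(** Phi is a total function, but only its values on [Dzeta p D] matter when D
    is open: [z + h] then stays in [Dzeta p D] for small h in [mu p]. *)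
Definition monogenic (p : R) (D : R * R -> Prop) (Phi : B0 -> B0) : Prop :=
  forall z : B0, Dzeta p D z -> exists l : B0, is_monogenic_derive p Phi z l.

Definition plane_connected (D : R * R -> Prop) : Prop :=
  forall V W : R * R -> Prop, open V -> open W ->
    (forall z, D z -> V z \/ W z) ->
    (exists z, D z /\ V z) -> (exists z, D z /\ W z) ->
    exists z, D z /\ V z /\ W z.

Definition plane_domain (D : R * R -> Prop) : Prop :=
  open D /\ (exists z, D z) /\ plane_connected D.

Definition plane_bounded (D : R * R -> Prop) : Prop :=
  exists M : R, forall x y : R, D (x, y) -> Rabs x <= M /\ Rabs y <= M.

Definition unit_interval (t : R) : Prop := 0 <= t <= 1.
Definition unit_square (q : R * R) : Prop :=
  unit_interval (fst q) /\ unit_interval (snd q).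

Definition path_in (D : R * R -> Prop) (g : R -> R * R) : Prop :=
  continuous_on unit_interval g /\ (forall t, unit_interval t -> D (g t)).

Definition path_connected (D : R * R -> Prop) : Prop :=
  forall a b : R * R, D a -> D b ->
    exists g : R -> R * R, path_in D g /\ g 0 = a /\ g 1 = b.

(** The loop g is contracted by [H (s, t)], s being the homotopy parameter,
    to its base point, with the base point kept fixed. *)
Definition null_homotopic (D : R * R -> Prop) (g : R -> R * R) : Prop :=
  exists H : R * R -> R * R,
    continuous_on unit_square H /\
    (forall q, unit_square q -> D (H q)) /\
    (forall t, unit_interval t -> H (0, t) = g t) /\
    (forall t, unit_interval t -> H (1, t) = g 0) /\
    (forall s, unit_interval s -> H (s, 0) = g 0 /\ H (s, 1) = g 0).

Definition simply_connected (D : R * R -> Prop) : Prop :=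
  path_connected D /\
  forall g : R -> R * R, path_in D g -> g 0 = g 1 -> null_homotopic D g.

(** [ex_diff_n u 4 x y] says that all iterated partial derivatives of u of order
    at most 4 exist and are continuous at (x, y); [partial_derive m k u] is the
    derivative m times in x and k times in y.  Only the values of u on the open
    set D matter. *)
Definition classical_solution (p : R) (D : R * R -> Prop) (u : R -> R -> R)
  : Prop :=
  forall x y : R, D (x, y) ->
    ex_diff_n u 4 x y /\
    partial_derive 0 4 u x y + (p ^ 2 + 1) * partial_derive 2 2 u x y
      + p ^ 2 * partial_derive 4 0 u x y = 0.

Ltac b0_unfold :=
  unfold comb, coord1, coord2, zeta, B0inv, B0mul, e2, e1, I1, I2, B0e, B0omega,
    zero, plus, minus, scal, opp, mult, Cdiv, Cinv, Cminus, Cmult, Cplus, Copp,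
    RtoC, Ci, Re, Im in *;
  simpl in *;
  unfold zero, plus, minus, scal, opp, mult, Cdiv, Cinv, Cminus, Cmult, Cplus,
    Copp, RtoC, Ci, Re, Im in *; simpl in *.

Lemma B0_eq (v w : B0) :
  fst (fst v) = fst (fst w) -> snd (fst v) = snd (fst w) ->
  fst (snd v) = fst (snd w) -> snd (snd v) = snd (snd w) -> v = w.
Proof.
destruct v as [[a b] [c d]], w as [[a' b'] [c' d']]; simpl.
now intros -> -> -> ->.
Qed.

Lemma B0mul_comm (v w : B0) : B0mul v w = B0mul w v.
Proof. destruct v, w; apply injective_projections; simpl; ring. Qed.

Lemma B0mul_assoc (u v w : B0) : B0mul u (B0mul v w) = B0mul (B0mul u v) w.
Proof. destruct u, v, w; apply injective_projections; simpl; ring. Qed.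

Lemma B0mul_e (w : B0) : B0mul B0e w = w.
Proof. destruct w; apply injective_projections; simpl; ring. Qed.

Lemma B0omega_sq : B0mul B0omega B0omega = B0e.
Proof. apply injective_projections; simpl; ring. Qed.

Lemma B0mul_inv (w : B0) :
  (fst w * fst w - snd w * snd w)%C <> RtoC 0 -> B0mul w (B0inv w) = B0e.
Proof.
destruct w as [a b]; simpl; intro Hd.
apply injective_projections; simpl; field; exact Hd.
Qed.

Lemma B0_invertible (w v : B0) :
  B0mul w v = B0e -> (fst w * fst w - snd w * snd w)%C <> RtoC 0.
Proof.
destruct w as [a b], v as [c d]; unfold B0mul, B0e; simpl.
intros H Hd; injection H as E1 E2 E3 E4.
assert (F1 : (a * c + b * d)%C = RtoC 1)
  by (apply injective_projections; assumption).
assert (F2 : (a * d + b * c)%C = RtoC 0)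
  by (apply injective_projections; assumption).
assert (F : RtoC 1 = ((a * a - b * b) * (c * c - d * d))%C).
{ transitivity ((a * c + b * d) * (a * c + b * d)
                - (a * d + b * c) * (a * d + b * c))%C.
  - rewrite F1, F2; ring.
  - ring. }
rewrite Hd, Cmult_0_l in F; apply (f_equal fst) in F; simpl in F; lra.
Qed.

Lemma e2_sq (p : R) :
  B0mul (e2 p) (e2 p) =
  plus (scal (RtoC p) e1) (scal (Ci * RtoC (p + 1))%C (e2 p)).
Proof. apply B0_eq; b0_unfold; field. Qed.

Lemma mu_invertible (p : R) (h : B0) :
  0 < p -> mu p h -> h <> zero -> B0mul h (B0inv h) = B0e.
Proof.
intros Hp [x [y ->]] Hh; apply B0mul_inv; intro H0; apply Hh.
assert (E : x * x - p * (y * y) = 0 /\ (1 + p) * (x * y) = 0).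
{ pose proof (f_equal fst H0) as Hr; pose proof (f_equal snd H0) as Hi.
  b0_unfold; split; [rewrite <- Hr | rewrite <- Hi]; field. }
destruct E as [Ea Eb].
assert (Exy : x * y = 0) by (apply Rmult_integral in Eb; lra).
assert (E : x = 0 /\ y = 0).
{ apply Rmult_integral in Exy as [-> | ->].
  - assert (y * y = 0) as Hy.
    { assert (p * (y * y) = 0) as Hy by lra.
      apply Rmult_integral in Hy; lra. }
    apply Rmult_integral in Hy; lra.
  - assert (x * x = 0) as Hx by lra.
    apply Rmult_integral in Hx; lra. }
destruct E as [-> ->].
apply B0_eq; b0_unfold; ring.
Qed.

Lemma U_decomposition (p : R) (w : B0) :
  p <> 1 -> w = comb p (U1 p w) (U2 p w) (U3 p w) (U4 p w).
Proof.
intro Hp; destruct w as [[a b] [c d]]; unfold U1, U2, U3, U4.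
apply B0_eq; b0_unfold; field; lra.
Qed.

Lemma U_unique (p u1 u2 u3 u4 : R) :
  p <> 1 ->
  let w := comb p u1 u2 u3 u4 in
  U1 p w = u1 /\ U2 p w = u2 /\ U3 p w = u3 /\ U4 p w = u4.
Proof.
intro Hp; unfold U1, U2, U3, U4.
repeat split; b0_unfold; field; lra.
Qed.

(* Main.v *)
Require Import Defs.
From Stdlib Require Import Reals Lra Lia Psatz IndefiniteDescription Classical.
From Coquelicot Require Import Coquelicot.
Open Scope R_scope.

(** In the idempotent basis, [zeta = (x + i y) I1 + (x + i p y) I2], so
    [F1 I1 + F2 I2] is monogenic as soon as F1 is holomorphic in [x + i y] and
    F2 in [x + i p y]; its U1 component is [Re (p F1 - F2) / (p - 1)].  The
    equation factors as [(dy^2 + dx^2) (dy^2 + p^2 dx^2) u = 0], hence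
    [v = u_yy + p^2 u_xx] is harmonic.  Let [V = v + i k] be holomorphic and let
    [a + i b] be a second primitive of V.  The harmonic function
    [h1 = a / (p^2 - 1)] satisfies [h1_yy + p^2 h1_xx = v], so [h2 = u - h1]
    solves [h2_yy + p^2 h2_xx = 0] and is the real part of a function that is
    holomorphic in [x + i p y].  Multiples of these two functions are F1 and F2.

    The conjugates and primitives exist because a closed form is exact on a
    simply connected domain.  As homotopies are merely continuous, integrals
    along paths are replaced by sums of increments over regular subdivisions:
    on a fine grid the increments around each cell cancel, so the sum along a
    null-homotopic loop vanishes for all fine subdivisions. *)

(** * Closed forms and their potentials on squares *)

Definition box (c : R * R) (r : R) (z : R * R) : Prop :=
  Rabs (fst z - fst c) < r /\ Rabs (snd z - snd c) < r.

(** [S] is the common value of the two cross derivatives; its continuity allows differentiation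
    under the integral sign. *)
Definition closed_form (D : R * R -> Prop) (P Q : R -> R -> R) : Prop :=
  exists S : R -> R -> R, forall x y, D (x, y) ->
    continuity_2d_pt P x y /\ continuity_2d_pt Q x y /\
    continuity_2d_pt S x y /\
    is_derive (fun z => P x z) y (S x y) /\
    is_derive (fun z => Q z y) x (S x y).

Definition gradient_on (D : R * R -> Prop) (f P Q : R -> R -> R) : Prop :=
  forall x y, D (x, y) ->
    is_derive (fun z => f z y) x (P x y) /\ is_derive (fun z => f x z) y (Q x y).

(** The integral of [P dx + Q dy] along the horizontal, then the vertical
    segment. *)
Definition increment (P Q : R -> R -> R) (a b : R * R) : R :=
  RInt (fun s => P s (snd a)) (fst a) (fst b) +
  RInt (fun t => Q (fst b) t) (snd a) (snd b).

Lemma increment_refl P Q a : increment P Q a a = 0.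
Proof.
  unfold increment; rewrite !RInt_point; unfold zero; simpl; ring.
Qed.

Lemma continuity_2d_pt_1d_l f x y :
  continuity_2d_pt f x y -> continuous (fun z => f z y) x.
Proof.
  intros H; apply filterlim_locally; intros eps.
  exact (locally_2d_1d_const_y _ _ _ (H eps)).
Qed.

Lemma continuity_2d_pt_1d_r f x y :
  continuity_2d_pt f x y -> continuous (fun z => f x z) y.
Proof.
  intros H; apply filterlim_locally; intros eps.
  exact (locally_2d_1d_const_x _ _ _ (H eps)).
Qed.

Lemma Rabs_between c r a b t :
  Rabs (a - c) < r -> Rabs (b - c) < r -> Rmin a b <= t <= Rmax a b ->
  Rabs (t - c) < r.
Proof.
  intros Ha Hb [H1 H2]; apply Rabs_def2 in Ha; apply Rabs_def2 in Hb.
  apply Rabs_def1; revert H1 H2; unfold Rmin, Rmax; destruct (Rle_dec a b); lra.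
Qed.

Lemma box_locally c r x y :
  box c r (x, y) -> locally_2d (fun u v => box c r (u, v)) x y.
Proof.
  intros [Hx Hy]; simpl in *.
  assert (He : 0 < Rmin (r - Rabs (x - fst c)) (r - Rabs (y - snd c)))
    by (apply Rmin_pos; lra).
  exists (mkposreal _ He); simpl; intros u v Hu Hv.
  pose proof (Rmin_l (r - Rabs (x - fst c)) (r - Rabs (y - snd c))).
  pose proof (Rmin_r (r - Rabs (x - fst c)) (r - Rabs (y - snd c))).
  split; simpl.
  - replace (u - fst c) with ((u - x) + (x - fst c)) by ring.
    pose proof (Rabs_triang (u - x) (x - fst c)); lra.
  - replace (v - snd c) with ((v - y) + (y - snd c)) by ring.
    pose proof (Rabs_triang (v - y) (y - snd c)); lra.
Qed.

(** Differentiation under the integral sign gives the x-derivative [P x y0] plus the integral of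
    [Q_x = S = P_y] from [y0] to [y], that is [P x y]. For the y-derivative only the vertical leg
    varies. *)
Lemma box_primitive P Q c r :
  closed_form (box c r) P Q ->
  gradient_on (box c r) (fun x y => increment P Q c (x, y)) P Q.
Proof.
  destruct c as [x0 y0]; intros [S HS] x y Hxy.
  (* A box that contains a point has positive radius, hence contains its centre. *)
  assert (Hc : Rabs (x0 - x0) < r /\ Rabs (y0 - y0) < r).
  { destruct Hxy as [H1 H2]; simpl in *.
    rewrite !Rminus_diag, Rabs_R0.
    pose proof (Rabs_pos (x - x0)); split; lra. }
  destruct Hc as [Hcx Hcy].
  unfold increment; simpl.
  split.
  - apply is_derive_ext with
      (f := fun z => plus (RInt (fun s => P s y0) x0 z)
                          (RInt (fun t => Q z t) y0 y)); [reflexivity|].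
    replace (P x y) with
      (plus (P x y0) (RInt (fun t => Derive (fun u => Q u t) x) y0 y)).
    2:{ rewrite (RInt_ext _ (fun t => S x t)).
        - assert (HI : is_RInt (fun t => S x t) y0 y (minus (P x y) (P x y0))).
          { apply (is_RInt_derive (fun t => P x t)).
            - intros t Ht; apply HS; split; simpl; [apply Hxy|].
              eapply Rabs_between; [exact Hcy | apply Hxy | exact Ht].
            - intros t Ht; apply continuity_2d_pt_1d_r, HS.
              split; simpl; [apply Hxy|].
              eapply Rabs_between; [exact Hcy | apply Hxy | exact Ht]. }
          rewrite (is_RInt_unique _ _ _ _ HI).
          unfold plus, minus, opp; simpl; unfold plus; simpl; ring.
        - intros t Ht; apply is_derive_unique, HS.
          split; simpl; [apply Hxy|].
          eapply Rabs_between; [exact Hcy | apply Hxy | simpl; lra]. }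
    assert (Hloc : locally x (fun z => Rabs (z - x0) < r)).
    { generalize (locally_2d_1d_const_y _ _ _ (box_locally _ _ _ _ Hxy)).
      apply filter_imp; intros z Hz; apply Hz. }
    apply @is_derive_plus.
    + apply (is_derive_RInt (fun s => P s y0)) with (a := x0).
      * revert Hloc; apply filter_imp; intros z Hz.
        apply (@RInt_correct R_CompleteNormedModule), @ex_RInt_continuous.
        intros t Ht; apply (continuity_2d_pt_1d_l P), HS; split; simpl;
          [eapply Rabs_between; [exact Hcx | exact Hz | exact Ht] | exact Hcy].
      * apply (continuity_2d_pt_1d_l P), HS; split; simpl; [apply Hxy | exact Hcy].
    + apply (is_derive_RInt_param (fun z t => Q z t)).
      * revert Hloc; apply filter_imp; intros z Hz t Ht.
        eexists; apply HS; split; simpl; [exact Hz|].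
        eapply Rabs_between; [exact Hcy | apply Hxy | exact Ht].
      * intros t Ht.
        assert (Hb : box (x0, y0) r (x, t)).
        { split; simpl; [apply Hxy|].
          eapply Rabs_between; [exact Hcy | apply Hxy | exact Ht]. }
        apply continuity_2d_pt_ext_loc with S; [|apply HS, Hb].
        apply locally_2d_impl with (2 := box_locally _ _ _ _ Hb).
        apply locally_2d_forall; intros u v Huv; symmetry.
        apply is_derive_unique, HS, Huv.
      * revert Hloc; apply filter_imp; intros z Hz.
        apply @ex_RInt_continuous; intros t Ht.
        apply (continuity_2d_pt_1d_r Q), HS; split; simpl; [exact Hz|].
        eapply Rabs_between; [exact Hcy | apply Hxy | exact Ht].
  - replace (Q x y) with (plus zero (Q x y)) by apply plus_zero_l.
    apply @is_derive_plus; [apply @is_derive_const|].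
    apply (is_derive_RInt (fun t => Q x t)) with (a := y0).
    + generalize (locally_2d_1d_const_x _ _ _ (box_locally _ _ _ _ Hxy)).
      apply filter_imp; intros z Hz.
      apply (@RInt_correct R_CompleteNormedModule), @ex_RInt_continuous.
      intros t Ht; apply (continuity_2d_pt_1d_r Q), HS; split; simpl;
        [apply Hxy|].
      eapply Rabs_between; [exact Hcy | apply Hz | exact Ht].
    + apply (continuity_2d_pt_1d_r Q), HS, Hxy.
Qed.

(** The fundamental theorem of calculus applies to each leg, since the corner between them stays in
    the box, a product of intervals. *)
Lemma increment_gradient f P Q c r a b :
  closed_form (box c r) P Q -> gradient_on (box c r) f P Q ->
  box c r a -> box c r b ->
  increment P Q a b = f (fst b) (snd b) - f (fst a) (snd a).
Proof.
  intros [S HS] Hf [Hax Hay] [Hbx Hby].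
  destruct a as [xa ya], b as [xb yb]; unfold increment; simpl in *.
  assert (H1 : is_RInt (fun s => P s ya) xa xb (minus (f xb ya) (f xa ya))).
  { apply (is_RInt_derive (fun s => f s ya)).
    - intros t Ht; apply (Hf t ya); split; simpl; [|exact Hay].
      eapply Rabs_between; [exact Hax | exact Hbx | exact Ht].
    - intros t Ht; apply (continuity_2d_pt_1d_l P), HS; split; simpl;
        [|exact Hay].
      eapply Rabs_between; [exact Hax | exact Hbx | exact Ht]. }
  assert (H2 : is_RInt (fun t => Q xb t) ya yb (minus (f xb yb) (f xb ya))).
  { apply (is_RInt_derive (fun t => f xb t)).
    - intros t Ht; apply (Hf xb t); split; simpl; [exact Hbx|].
      eapply Rabs_between; [exact Hay | exact Hby | exact Ht].
    - intros t Ht; apply (continuity_2d_pt_1d_r Q), HS; split; simpl;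
        [exact Hbx|].
      eapply Rabs_between; [exact Hay | exact Hby | exact Ht]. }
  rewrite (is_RInt_unique _ _ _ _ H1), (is_RInt_unique _ _ _ _ H2).
  change ((f xb ya - f xa ya) + (f xb yb - f xb ya) = f xb yb - f xa ya); ring.
Qed.

(** Differences of the local potential from [box_primitive] telescope. *)
Lemma increment_chasles P Q c r a b d :
  closed_form (box c r) P Q -> box c r a -> box c r b -> box c r d ->
  increment P Q a b + increment P Q b d = increment P Q a d.
Proof.
  intros HF Ha Hb Hd; pose proof (box_primitive _ _ _ _ HF) as HG.
  pose proof (fun a b => increment_gradient _ _ _ _ _ a b HF HG) as H.
  rewrite (H a b), (H b d), (H a d) by assumption; ring.
Qed.

Lemma closed_form_subset (D E : R * R -> Prop) P Q :
  (forall z, E z -> D z) -> closed_form D P Q -> closed_form E P Q.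
Proof.
  intros H [S HS]; exists S; intros x y Hxy; apply HS, H, Hxy.
Qed.

Lemma open_box (D : R * R -> Prop) z :
  open D -> D z -> exists r, 0 < r /\ forall w, box z r w -> D w.
Proof.
  intros HD Hz; destruct (HD z Hz) as [e He].
  exists e; split; [apply cond_pos|].
  intros w [H1 H2]; apply He; split; assumption.
Qed.

(** * Sums of increments along subdivided paths *)

Fixpoint chain_sum (P Q : R -> R -> R) (z : nat -> R * R) (n : nat) : R :=
  match n with
  | O => 0
  | S m => chain_sum P Q z m + increment P Q (z m) (z (S m))
  end.

Definition path_sum (P Q : R -> R -> R) (g : R -> R * R) (N : nat) : R :=
  chain_sum P Q (fun i => g (INR i / INR N)) N.

Lemma chain_sum_ext P Q z w n :
  (forall i, (i <= n)%nat -> z i = w i) -> chain_sum P Q z n = chain_sum P Q w n.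
Proof.
  induction n as [|n IH]; intros H; [reflexivity|]; simpl.
  rewrite IH, (H n), (H (S n)); auto with arith.
Qed.

Lemma chain_sum_add P Q z m n :
  chain_sum P Q z (m + n) =
  chain_sum P Q z m + chain_sum P Q (fun i => z (m + i)%nat) n.
Proof.
  induction n as [|n IH]; simpl.
  - rewrite Nat.add_0_r; ring.
  - rewrite Nat.add_succ_r; simpl; rewrite IH; ring.
Qed.

Lemma chain_sum_const P Q a n : chain_sum P Q (fun _ => a) n = 0.
Proof.
  induction n as [|n IH]; simpl; [reflexivity|].
  rewrite IH, increment_refl; ring.
Qed.

Lemma chain_sum_box P Q c r z n :
  closed_form (box c r) P Q -> (forall i, (i <= n)%nat -> box c r (z i)) ->
  chain_sum P Q z n = increment P Q (z O) (z n).
Proof.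
  intros HF; induction n as [|n IH]; intros H; simpl.
  - now rewrite increment_refl.
  - rewrite IH by auto with arith.
    apply (increment_chasles _ _ _ _ _ _ _ HF); apply H; auto with arith.
Qed.

(** * Vanishing of sums along null-homotopic loops *)

Definition small_cell (P Q : R -> R -> R) (a b d e : R * R) : Prop :=
  exists c r, closed_form (box c r) P Q /\
    box c r a /\ box c r b /\ box c r d /\ box c r e.

(** In each cell both ways from [z j] to [w (S j)] amount to the direct increment, as one box holds
    all four corners. The rungs [z j] to [w j] shared by neighbouring cells cancel, except the first
    and the last. *)
Lemma chain_sum_strip P Q (z w : nat -> R * R) n :
  (forall j, (j < n)%nat -> small_cell P Q (z j) (z (S j)) (w j) (w (S j))) ->
  chain_sum P Q z n + increment P Q (z n) (w n) =
  increment P Q (z O) (w O) + chain_sum P Q w n.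
Proof.
  induction n as [|n IH]; intros H; simpl; [ring|].
  destruct (H n (Nat.lt_succ_diag_r n)) as (c & r & HF & H1 & H2 & H3 & H4).
  pose proof (increment_chasles _ _ _ _ _ _ _ HF H1 H2 H4).
  pose proof (increment_chasles _ _ _ _ _ _ _ HF H1 H3 H4).
  assert (Hn : forall j, (j < n)%nat ->
    small_cell P Q (z j) (z (S j)) (w j) (w (S j))) by (intros; apply H; lia).
  specialize (IH Hn); lra.
Qed.

(** A Lebesgue number argument: around each [q], continuity gives a radius within which [H] stays in
    one box of [D], and compactness of the square makes the radii uniform. *)
Lemma small_cells P Q (D : R * R -> Prop) (H : R * R -> R * R) :
  open D -> closed_form D P Q -> continuous_on unit_square H ->
  (forall q, unit_square q -> D (H q)) ->
  exists N0, (0 < N0)%nat /\ forall N, (N0 <= N)%nat ->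
    forall i j, (i < N)%nat -> (j < N)%nat ->
    let z i j := H (INR i / INR N, INR j / INR N) in
    small_cell P Q (z i j) (z i (S j)) (z (S i) j) (z (S i) (S j)).
Proof.
  intros HD HF Hc HH.
  (* The radius is doubled because a grid point lies within [delta] of some [(u, v)] and its
     neighbours lie less than [d <= delta] further away. *)
  assert (Hloc : forall q : R * R, exists d : posreal, unit_square q ->
    exists c r, closed_form (box c r) P Q /\
      forall x y, Rabs (x - fst q) < 2 * d -> Rabs (y - snd q) < 2 * d ->
        unit_square (x, y) -> box c r (H (x, y))).
  { intros q; destruct (classic (unit_square q)) as [Hq|Hq].
    (* Off the square the radius is a dummy, so that choice yields a total function. *)
    2:{ exists (mkposreal 1 Rlt_0_1); tauto. }
    destruct (open_box D (H q) HD (HH q Hq)) as (r & Hr & HDr).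
    destruct (proj1 (filterlim_locally _ _) (Hc q Hq) (mkposreal r Hr))
      as [e He].
    exists (mkposreal (e / 2) (is_pos_div_2 e)); intros _.
    exists (H q), r; split; [exact (closed_form_subset _ _ _ _ HDr HF)|].
    intros x y Hx Hy Hxy; simpl in Hx, Hy.
    apply (He (x, y)); [|exact Hxy].
    replace (2 * (e / 2)) with (pos e) in Hx, Hy by field.
    split; assumption. }
  apply functional_choice in Hloc; destruct Hloc as [delta Hdelta].
  destruct (compactness_value_2d 0 1 0 1 (fun u v => delta (u, v)))
    as [d Hd].
  destruct (archimed_cor1 d (cond_pos d)) as (N0 & HN0 & HN0').
  exists N0; split; [exact HN0'|].
  intros N HN i j Hi Hj z.
  assert (HNpos : 0 < INR N) by (apply lt_0_INR; lia).
  assert (HNd : / INR N < d).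
  { apply Rle_lt_trans with (2 := HN0); apply Rinv_le_contravar.
    - apply lt_0_INR; lia.
    - apply le_INR; lia. }
  assert (Hu : forall k, (k <= N)%nat -> 0 <= INR k / INR N <= 1).
  { intros k Hk; split.
    - apply Rle_div_r; [exact HNpos|]; rewrite Rmult_0_l; apply pos_INR.
    - apply Rle_div_l; [exact HNpos|]; rewrite Rmult_1_l; apply le_INR; lia. }
  assert (HS : forall k, INR (S k) / INR N = INR k / INR N + / INR N).
  { intros k; rewrite S_INR; field; lra. }
  assert (HSpos : 0 < / INR N) by (apply Rinv_0_lt_compat; lra).
  (* Compactness provides the centre [(u, v)] only under a double negation. *)
  apply NNPP; intros Hn.
  apply (Hd (INR i / INR N) (INR j / INR N)); [apply Hu; lia | apply Hu; lia |].
  intros (u & v & Hu0 & Hv0 & Hxu & Hyv & Hdd); apply Hn; clear Hn.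
  destruct (Hdelta (u, v)) as (c & r & HF' & Hb); [split; assumption|].
  exists c, r; split; [exact HF'|].
  assert (Hsq : forall k l, (k <= N)%nat -> (l <= N)%nat ->
    unit_square (INR k / INR N, INR l / INR N)).
  { intros k l Hk Hl; split; simpl; apply Hu; assumption. }
  apply Rabs_def2 in Hxu; apply Rabs_def2 in Hyv.
  unfold z; repeat split;
    match goal with |- context [H (INR ?k / _, INR ?l / _)] =>
      apply (Hb (INR k / INR N) (INR l / INR N)) end;
    try (apply Hsq; lia); simpl fst; simpl snd; rewrite ?HS;
    apply Rabs_def1; lra.
Qed.

(** Successive rows of the homotopy grid have equal sums by [chain_sum_strip]: the ends of every row
    stay at the base point, so the outer rungs vanish. The first row is [g], the last one is
    constant. *)
Lemma loop_sum_eq_0 P Q (D : R * R -> Prop) g :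
  open D -> simply_connected D -> closed_form D P Q ->
  path_in D g -> g 0 = g 1 ->
  exists N0, (0 < N0)%nat /\
    forall N, (N0 <= N)%nat -> path_sum P Q g N = 0.
Proof.
  intros HD [_ Hsc] HF Hg Hg01.
  destruct (Hsc g Hg Hg01) as (H & Hc & HDH & H0 & H1 & Hs).
  destruct (small_cells P Q D H HD HF Hc HDH) as (N0 & HN0 & Hcell).
  exists N0; split; [exact HN0|]; intros N HN.
  specialize (Hcell N HN).
  assert (HNpos : 0 < INR N) by (apply lt_0_INR; lia).
  assert (Hu : forall k, (k <= N)%nat -> unit_interval (INR k / INR N)).
  { intros k Hk; split.
    - apply Rle_div_r; [exact HNpos|]; rewrite Rmult_0_l; apply pos_INR.
    - apply Rle_div_l; [exact HNpos|]; rewrite Rmult_1_l; apply le_INR; lia. }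
  assert (E0 : INR 0 / INR N = 0) by (simpl; field; lra).
  assert (E1 : INR N / INR N = 1) by (field; lra).
  set (z := fun i j : nat => H (INR i / INR N, INR j / INR N)) in *.
  assert (Hrow : forall i, (i <= N)%nat ->
    chain_sum P Q (z i) N = chain_sum P Q (z O) N).
  { induction i as [|i IH]; intros Hi; [reflexivity|].
    rewrite <- IH by lia.
    pose proof (chain_sum_strip P Q (z i) (z (S i)) N
      (fun j Hj => Hcell i j Hi Hj)) as E.
    assert (Hside : forall k, (k <= N)%nat -> z k O = g 0 /\ z k N = g 0).
    { intros k Hk; unfold z; rewrite E0, E1; apply Hs, Hu, Hk. }
    destruct (Hside i) as [-> ->] in E; [lia|].
    destruct (Hside (S i)) as [-> ->] in E; [lia|].
    rewrite increment_refl in E; lra. }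
  transitivity (chain_sum P Q (z O) N).
  - apply chain_sum_ext; intros j Hj; unfold z; rewrite E0.
    symmetry; apply H0, Hu, Hj.
  - rewrite <- (Hrow N) by lia.
    rewrite (chain_sum_ext _ _ _ (fun _ => g 0)); [apply chain_sum_const|].
    intros j Hj; unfold z; rewrite E1; apply H1, Hu, Hj.
Qed.

(** * Concatenation of paths, and segments *)

Definition clamp (t : R) : R := Rmax 0 (Rmin 1 t).

Lemma clamp_unit t : unit_interval (clamp t).
Proof.
  unfold clamp, unit_interval, Rmax, Rmin.
  repeat destruct Rle_dec; lra.
Qed.

Lemma clamp_id t : 0 <= t <= 1 -> clamp t = t.
Proof. unfold clamp, Rmax, Rmin; repeat destruct Rle_dec; lra. Qed.

Lemma clamp_le0 t : t <= 0 -> clamp t = 0.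
Proof. unfold clamp, Rmax, Rmin; repeat destruct Rle_dec; lra. Qed.

Lemma clamp_ge1 t : 1 <= t -> clamp t = 1.
Proof. unfold clamp, Rmax, Rmin; repeat destruct Rle_dec; lra. Qed.

(** [clamp] does not increase distances and has values in the interval, so continuity relative to
    the interval becomes continuity on the line. *)
Lemma continuous_clamp (g : R -> R * R) t :
  continuous_on unit_interval g -> continuous (fun s => g (clamp s)) t.
Proof.
  intros Hg P HP.
  destruct (Hg (clamp t) (clamp_unit t) P HP) as [d Hd].
  exists d; intros s Hs; apply Hd; [|apply clamp_unit].
  change (Rabs (clamp s - clamp t) < d); change (Rabs (s - t) < d) in Hs.
  apply Rabs_def2 in Hs; apply Rabs_def1;
  unfold clamp, Rmax, Rmin; repeat destruct Rle_dec; lra.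
Qed.

Lemma continuous_within (E : R -> Prop) (g : R -> R * R) t :
  continuous g t -> filterlim g (within E (locally t)) (locally (g t)).
Proof.
  intros H P HP; generalize (H P HP); unfold filtermap, within.
  apply filter_imp; auto.
Qed.

(** The path [g] followed by [k], their durations being in the ratio m : n.
    Written as a sum, with [g] and [k] frozen outside their time intervals, so
    that continuity needs no gluing. *)
Definition concat (m n : nat) (g k : R -> R * R) (t : R) : R * R :=
  plus (g (clamp (INR (m + n) * t / INR m)))
       (minus (k (clamp ((INR (m + n) * t - INR m) / INR n))) (g 1)).

(** During this time [k] is frozen at [k 0], which the subtracted [g 1] cancels. *)
Lemma concat_l m n g k t :
  (0 < m)%nat -> (0 < n)%nat -> g 1 = k 0 -> 0 <= INR (m + n) * t <= INR m ->
  concat m n g k t = g (INR (m + n) * t / INR m).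
Proof.
  intros Hm Hn Hgk Ht; unfold concat.
  assert (0 < INR m) by now apply lt_0_INR.
  assert (0 < INR n) by now apply lt_0_INR.
  rewrite clamp_id, clamp_le0, <- Hgk, minus_eq_zero; [apply plus_zero_r| |].
  - apply Rle_div_l; lra.
  - split; [apply Rle_div_r | apply Rle_div_l]; lra.
Qed.

Lemma concat_r m n g k t :
  (0 < m)%nat -> (0 < n)%nat -> INR m <= INR (m + n) * t <= INR (m + n) ->
  concat m n g k t = k ((INR (m + n) * t - INR m) / INR n).
Proof.
  intros Hm Hn Ht; unfold concat.
  assert (0 < INR m) by now apply lt_0_INR.
  assert (0 < INR n) by now apply lt_0_INR.
  rewrite clamp_ge1, clamp_id.
  - apply injective_projections; unfold minus, plus, opp; simpl;
      unfold plus, opp; simpl; ring.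
  - rewrite plus_INR in *.
    split; [apply Rle_div_r | apply Rle_div_l]; lra.
  - apply Rle_div_r; lra.
Qed.

Lemma concat_path m n (D : R * R -> Prop) g k :
  (0 < m)%nat -> (0 < n)%nat -> path_in D g -> path_in D k -> g 1 = k 0 ->
  path_in D (concat m n g k) /\
  concat m n g k 0 = g 0 /\ concat m n g k 1 = k 1.
Proof.
  intros Hm Hn [Hgc HgD] [Hkc HkD] Hgk.
  assert (0 < INR m) by now apply lt_0_INR.
  assert (0 < INR n) by now apply lt_0_INR.
  assert (E : INR (m + n) = INR m + INR n) by apply plus_INR.
  repeat split.
  - intros t _; apply continuous_within.
    apply (@continuous_plus R_UniformSpace R_AbsRing
             (prod_NormedModule R_AbsRing R_NormedModule R_NormedModule)).
    + apply (continuous_comp (fun t => INR (m + n) * t / INR m)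
               (fun s => g (clamp s))); [|now apply continuous_clamp].
      apply (ex_derive_continuous (fun t => INR (m + n) * t / INR m)).
      auto_derive; trivial.
    + apply (@continuous_plus R_UniformSpace R_AbsRing
             (prod_NormedModule R_AbsRing R_NormedModule R_NormedModule)).
      * apply (continuous_comp (fun t => (INR (m + n) * t - INR m) / INR n)
               (fun s => k (clamp s))); [|now apply continuous_clamp].
        apply (ex_derive_continuous (fun t => (INR (m + n) * t - INR m) / INR n)).
        auto_derive; trivial.
      * apply continuous_const.
  - intros t [Ht0 Ht1].
    destruct (Rle_dec (INR (m + n) * t) (INR m)) as [Ht|Ht].
    + assert (0 <= INR (m + n) * t) by (apply Rmult_le_pos; lra).
      rewrite concat_l by (trivial; lra).
      apply HgD; split; [apply Rle_div_r | apply Rle_div_l]; lra.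
    + assert (INR (m + n) * t <= INR (m + n) * 1)
        by (apply Rmult_le_compat_l; lra).
      rewrite concat_r by (trivial; lra).
      apply HkD; split; [apply Rle_div_r | apply Rle_div_l]; lra.
  - rewrite concat_l by (trivial; lra); f_equal; field; lra.
  - rewrite concat_r by (trivial; lra); f_equal; rewrite E; field; lra.
Qed.

(** With [(m + n) * N] pieces the junction is exactly the node of index [m * N], so no piece
    straddles it. *)
Lemma path_sum_concat P Q m n g k N :
  (0 < m)%nat -> (0 < n)%nat -> (0 < N)%nat -> g 1 = k 0 ->
  path_sum P Q (concat m n g k) ((m + n) * N) =
  path_sum P Q g (m * N) + path_sum P Q k (n * N).
Proof.
  intros Hm Hn HN Hgk.
  assert (0 < INR m) by now apply lt_0_INR.
  assert (0 < INR n) by now apply lt_0_INR.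
  assert (0 < INR N) by now apply lt_0_INR.
  assert (Hmn : INR (m + n) = INR m + INR n) by apply plus_INR.
  transitivity (chain_sum P Q
    (fun i => concat m n g k (INR i / INR ((m + n) * N))) (m * N + n * N)).
  { unfold path_sum; f_equal; ring. }
  rewrite chain_sum_add; f_equal; apply chain_sum_ext; intros i Hi;
    apply le_INR in Hi; rewrite ?mult_INR in Hi.
  - assert (E : INR (m + n) * (INR i / INR ((m + n) * N)) = INR i / INR N).
    { rewrite mult_INR, Hmn; field; split; lra. }
    pose proof (pos_INR i).
    rewrite concat_l; trivial; rewrite E.
    + f_equal; rewrite mult_INR; field; split; lra.
    + split; [apply Rle_div_r | apply Rle_div_l]; lra.
  - assert (E : INR (m + n) * (INR (m * N + i) / INR ((m + n) * N)) =
      INR m + INR i / INR N).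
    { rewrite !plus_INR, !mult_INR, Hmn; field; split; lra. }
    pose proof (pos_INR i).
    assert (0 <= INR i / INR N <= INR n)
      by (split; [apply Rle_div_r | apply Rle_div_l]; lra).
    rewrite concat_r; trivial; rewrite E.
    + f_equal; rewrite mult_INR; field; split; lra.
    + lra.
Qed.

Definition segment (a b : R * R) (t : R) : R * R :=
  (fst a + t * (fst b - fst a), snd a + t * (snd b - snd a)).

Lemma segment_0 a b : segment a b 0 = a.
Proof. destruct a; unfold segment; simpl; f_equal; ring. Qed.

Lemma segment_1 a b : segment a b 1 = b.
Proof. destruct b; unfold segment; simpl; f_equal; ring. Qed.

Lemma segment_box c r a b t :
  box c r a -> box c r b -> 0 <= t <= 1 -> box c r (segment a b t).
Proof.
  intros [Ha1 Ha2] [Hb1 Hb2] Ht; split; simpl;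
    [apply (Rabs_between _ _ _ _ _ Ha1 Hb1) | apply (Rabs_between _ _ _ _ _ Ha2 Hb2)];
    unfold Rmin, Rmax; destruct Rle_dec; split; nra.
Qed.

Lemma segment_path (D : R * R -> Prop) c r a b :
  (forall z, box c r z -> D z) -> box c r a -> box c r b ->
  path_in D (segment a b).
Proof.
  intros HD Ha Hb; split.
  - intros t _; apply continuous_within.
    apply (continuous_comp_2 (fun t => fst a + t * (fst b - fst a))
             (fun t => snd a + t * (snd b - snd a)) (fun x y => (x, y)));
      [apply (ex_derive_continuous (fun t => fst a + t * (fst b - fst a)))
      |apply (ex_derive_continuous (fun t => snd a + t * (snd b - snd a)))|];
      try (auto_derive; trivial).
    apply filterlim_ext with (fun z => z); [now intros []|apply filterlim_id].
  - intros t Ht; now apply HD, segment_box.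
Qed.

(** All nodes lie in the convex box, where the sum telescopes by [chain_sum_box]. *)
Lemma path_sum_segment P Q c r a b N :
  closed_form (box c r) P Q -> box c r a -> box c r b -> (0 < N)%nat ->
  path_sum P Q (segment a b) N = increment P Q a b.
Proof.
  intros HF Ha Hb HN.
  assert (0 < INR N) by now apply lt_0_INR.
  unfold path_sum; rewrite (chain_sum_box _ _ _ _ _ _ HF).
  - replace (INR 0 / INR N) with 0 by (simpl; field; lra).
    replace (INR N / INR N) with 1 by (field; lra).
    now rewrite segment_0, segment_1.
  - intros i Hi; apply segment_box; trivial.
    apply le_INR in Hi; pose proof (pos_INR i).
    split; [apply Rle_div_r | apply Rle_div_l]; lra.
Qed.

(** * Exactness of closed forms on simply connected domains *)

Lemma increment_path_sums P Q (D : R * R -> Prop) a g k c r b b' :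
  open D -> simply_connected D -> closed_form D P Q ->
  path_in D g -> g 0 = a -> g 1 = b -> path_in D k -> k 0 = b' -> k 1 = a ->
  (forall z, box c r z -> D z) -> box c r b -> box c r b' ->
  exists N0, (0 < N0)%nat /\ forall N, (N0 <= N)%nat ->
    path_sum P Q g N + increment P Q b b' + path_sum P Q k N = 0.
Proof.
  intros HD Hsc HF Hgc Hgc0 Hgc1 Hkb Hk0 Hk1 Hbox Hb Hb'.
  pose proof (segment_path D c r b b' Hbox Hb Hb') as Hs.
  destruct (concat_path 1 1 D (segment b b') k) as (Hc & Hc0 & Hc1);
    [lia | lia | trivial | trivial | now rewrite segment_1, Hk0 |].
  rewrite segment_0 in Hc0.
  (* The ratio 1 : 2, with the second part again split 1 : 1, gives [g], the segment and [k] equal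
     durations: [3 * N] pieces leave [N] to each. *)
  destruct (concat_path 1 2 D g (concat 1 1 (segment b b') k))
    as (Hl & Hl0 & Hl1); [lia | lia | trivial | trivial | congruence |].
  destruct (loop_sum_eq_0 P Q D _ HD Hsc HF Hl) as (N0 & HN0 & H);
    [congruence|].
  exists N0; split; [exact HN0|]; intros N HN.
  specialize (H ((1 + 2) * N)%nat ltac:(lia)).
  rewrite path_sum_concat in H by (try lia; congruence).
  change (2 * N)%nat with ((1 + 1) * N)%nat in H.
  rewrite path_sum_concat in H by (try lia; rewrite segment_1; congruence).
  rewrite !Nat.mul_1_l in H.
  rewrite (path_sum_segment _ _ c r) in H;
    [lra | apply (closed_form_subset D); trivial | trivial | trivial | lia].
Qed.

(** For large [N], the sum along [k] in [2 * N] pieces is opposite both to that along [g] in [2 * N]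
    pieces and to that along [g] in [N] pieces. Hence doubling [N] changes nothing, and the powers
    of two give an eventually constant sequence. *)
Lemma path_sum_eventually_const P Q (D : R * R -> Prop) a b g k :
  open D -> simply_connected D -> closed_form D P Q ->
  path_in D g -> g 0 = a -> g 1 = b -> path_in D k -> k 0 = b -> k 1 = a ->
  exists v n0, forall n, (n0 <= n)%nat -> path_sum P Q g (2 ^ n) = v.
Proof.
  intros HD Hsc HF Hg Hg0 Hg1 Hk Hk0 Hk1.
  assert (HDb : D b) by (rewrite <- Hk0; apply Hk; split; lra).
  destruct (open_box D b HD HDb) as (r & Hr & Hbox).
  assert (Hb : box b r b)
    by (split; rewrite Rminus_diag, Rabs_R0; exact Hr).
  destruct (increment_path_sums P Q D a g k b r b b) as (N1 & HN1 & H1);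
    trivial.
  (* the loop running through [k] at half speed compares the subdivisions
     of [k] into N and 2N pieces *)
  destruct (concat_path 1 2 D g k) as (Hl & Hl0 & Hl1);
    [lia | lia | trivial | trivial | congruence |].
  destruct (loop_sum_eq_0 P Q D _ HD Hsc HF Hl) as (N2 & HN2 & H2);
    [congruence|].
  assert (Hdouble : forall N, (N1 + N2 <= N)%nat ->
    path_sum P Q g (2 * N) = path_sum P Q g N).
  { intros N HN.
    pose proof (H1 (2 * N)%nat ltac:(lia)) as E1.
    specialize (H2 ((1 + 2) * N)%nat ltac:(lia)).
    rewrite path_sum_concat in H2 by (try lia; congruence).
    rewrite Nat.mul_1_l in H2; rewrite increment_refl in E1; lra. }
  exists (path_sum P Q g (2 ^ (N1 + N2))), (N1 + N2)%nat.
  intros n Hn; induction Hn as [|n Hn IH]; [reflexivity|].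
  rewrite <- IH; simpl Nat.pow; apply Hdouble.
  pose proof (Nat.pow_gt_lin_r 2 n ltac:(lia)); lia.
Qed.

(** The potential at [b] is the eventual value of the sums along a chosen path from a base point [a]
    to [b]. Near a point it differs by a constant from the local potential of [box_primitive]. *)
Lemma closed_form_exact P Q (D : R * R -> Prop) :
  open D -> simply_connected D -> closed_form D P Q ->
  exists f, gradient_on D f P Q.
Proof.
  intros HD Hsc HF.
  destruct (classic (exists a, D a)) as [[a Ha]|Hempty].
  2:{ exists (fun _ _ => 0); intros x y Hxy; destruct Hempty; eauto. }
  (* Memberships are placed under the existential, with a constant path as dummy, so that choice
     applies to all points of the plane. *)
  assert (Hpath : forall b c : R * R, exists g : R -> R * R,
    D b -> D c -> path_in D g /\ g 0 = b /\ g 1 = c).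
  { intros b c; destruct (classic (D b)) as [Hb|Hb];
      [destruct (classic (D c)) as [Hc|Hc]|].
    - destruct (proj1 Hsc b c Hb Hc) as [g Hg]; exists g; trivial.
    - exists (fun _ => a); tauto.
    - exists (fun _ => a); tauto. }
  pose proof (functional_choice _ (Hpath a)) as [g Hg].
  pose proof (functional_choice _ (fun b => Hpath b a)) as [k Hk].
  assert (Hval : forall b, exists v : R, D b ->
    exists n0, forall n, (n0 <= n)%nat ->
      path_sum P Q (g b) (2 ^ n) = v).
  { intros b; destruct (classic (D b)) as [Hb|Hb].
    2:{ exists 0; tauto. }
    destruct (Hg b Ha Hb) as (Hg' & Hg0 & Hg1).
    destruct (Hk b Hb Ha) as (Hk' & Hk0 & Hk1).
    destruct (path_sum_eventually_const P Q D a b _ _ HD Hsc HF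
      Hg' Hg0 Hg1 Hk' Hk0 Hk1) as [v Hv].
    exists v; trivial. }
  apply functional_choice in Hval; destruct Hval as [F HFv].
  (* One return path from [b] to [a] closes two loops, one through [c] and the segment from [c] to
     [b], the other through the path chosen for [b]; subtraction eliminates it. *)
  assert (Hinc : forall c r b, (forall z, box c r z -> D z) ->
    box c r c -> box c r b -> F b = F c + increment P Q c b).
  { intros c r b Hbox Hc Hb.
    destruct (Hg c Ha (Hbox c Hc)) as (Hgc & Hgc0 & Hgc1).
    destruct (Hg b Ha (Hbox b Hb)) as (Hgb & Hgb0 & Hgb1).
    destruct (Hk b (Hbox b Hb) Ha) as (Hkb & Hk0 & Hk1).
    destruct (HFv c (Hbox c Hc)) as [n1 Hn1].
    destruct (HFv b (Hbox b Hb)) as [n2 Hn2].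
    destruct (increment_path_sums P Q D a _ _ c r c b HD Hsc HF
      Hgc Hgc0 Hgc1 Hkb Hk0 Hk1 Hbox Hc Hb) as (N3 & _ & H3).
    destruct (increment_path_sums P Q D a _ _ c r b b HD Hsc HF
      Hgb Hgb0 Hgb1 Hkb Hk0 Hk1 Hbox Hb Hb) as (N4 & _ & H4).
    set (n := (n1 + n2 + N3 + N4)%nat).
    pose proof (Nat.pow_gt_lin_r 2 n ltac:(lia)).
    specialize (Hn1 n ltac:(lia)); specialize (Hn2 n ltac:(lia)).
    specialize (H3 (2 ^ n)%nat ltac:(lia)); specialize (H4 (2 ^ n)%nat ltac:(lia)).
    rewrite increment_refl in H4; lra. }
  exists (fun x y => F (x, y)); intros x y Hxy.
  destruct (open_box D (x, y) HD Hxy) as (r & Hr & Hbox).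
  assert (Hc : box (x, y) r (x, y))
    by (split; rewrite Rminus_diag, Rabs_R0; exact Hr).
  destruct (box_primitive P Q (x, y) r
    (closed_form_subset _ _ _ _ Hbox HF) x y Hc) as [H1 H2].
  split.
  - apply is_derive_ext_loc with
      (fun z => plus (F (x, y)) (increment P Q (x, y) (z, y))).
    + generalize (locally_2d_1d_const_y _ _ _ (box_locally _ _ _ _ Hc)).
      apply filter_imp; intros z Hz; symmetry; exact (Hinc _ r _ Hbox Hc Hz).
    + replace (P x y) with (plus zero (P x y)) by apply plus_zero_l.
      apply @is_derive_plus; [apply @is_derive_const | exact H1].
  - apply is_derive_ext_loc with
      (fun z => plus (F (x, y)) (increment P Q (x, y) (x, z))).
    + generalize (locally_2d_1d_const_x _ _ _ (box_locally _ _ _ _ Hc)).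
      apply filter_imp; intros z Hz; symmetry; exact (Hinc _ r _ Hbox Hc Hz).
    + replace (Q x y) with (plus zero (Q x y)) by apply plus_zero_l.
      apply @is_derive_plus; [apply @is_derive_const | exact H2].
Qed.

(** * Conjugates, primitives and monogenic functions *)

Lemma open_locally_2d (D : R * R -> Prop) x y :
  open D -> D (x, y) -> locally_2d (fun u v => D (u, v)) x y.
Proof.
  intros HD Hxy; destruct (HD _ Hxy) as [e He].
  exists e; intros u v Hu Hv; apply He; split; assumption.
Qed.

(** Total differentiability follows from an x-derivative that exists nearby and is continuous at the
    point, together with the y-derivative at the point. *)
Lemma gradient_on_differentiable (D : R * R -> Prop) f P Q x y :
  open D -> gradient_on D f P Q -> D (x, y) -> continuity_2d_pt P x y ->
  differentiable_pt_lim f x y (P x y) (Q x y).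
Proof.
  intros HD Hf Hxy HP; apply filterdiff_differentiable_pt_lim.
  apply (is_derive_filterdiff f x y P (Q x y)).
  - apply (locally_2d_locally (fun u v => is_derive (fun z => f z v) u (P u v))).
    apply locally_2d_impl with (2 := open_locally_2d D x y HD Hxy).
    apply locally_2d_forall; intros u v Huv; apply (Hf u v Huv).
  - apply (Hf x y Hxy).
  - now apply continuity_2d_pt_filterlim.
Qed.

Lemma gradient_on_continuity (D : R * R -> Prop) f P Q x y :
  open D -> gradient_on D f P Q -> D (x, y) -> continuity_2d_pt P x y ->
  continuity_2d_pt f x y.
Proof.
  intros HD Hf Hxy HP; apply differentiable_continuity_pt.
  exists (P x y), (Q x y); now apply gradient_on_differentiable with D.
Qed.

(** [f + i g] is holomorphic in [x + i q y] with complex derivative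
    [alpha + i beta]. *)
Definition cauchy_riemann (q : R) (D : R * R -> Prop)
    (f g alpha beta : R -> R -> R) : Prop :=
  gradient_on D f alpha (fun x y => - (q * beta x y)) /\
  gradient_on D g beta (fun x y => q * alpha x y) /\
  forall x y, D (x, y) ->
    continuity_2d_pt alpha x y /\ continuity_2d_pt beta x y.

Lemma is_derive_eq (f : R -> R) (x l l' : R) :
  is_derive f x l -> l = l' -> is_derive f x l'.
Proof. now intros H <-. Qed.

(** [F] and [G] are potentials of the real and imaginary parts of [(f + i g)(dx + i dy)], namely
    [f dx - g dy] and [g dx + f dy]. The Cauchy-Riemann equations make both closed, with cross
    derivatives [- beta] and [alpha]. *)
Lemma cauchy_riemann_primitive (D : R * R -> Prop) f g alpha beta :
  open D -> simply_connected D -> cauchy_riemann 1 D f g alpha beta ->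
  exists F G, cauchy_riemann 1 D F G f g.
Proof.
  intros HD Hsc (Hf & Hg & Hc).
  assert (Hcf : forall x y, D (x, y) -> continuity_2d_pt f x y).
  { intros x y Hxy; apply (gradient_on_continuity D f _ _ x y HD Hf Hxy).
    now apply Hc. }
  assert (Hcg : forall x y, D (x, y) -> continuity_2d_pt g x y).
  { intros x y Hxy; apply (gradient_on_continuity D g _ _ x y HD Hg Hxy).
    now apply Hc. }
  destruct (closed_form_exact f (fun x y => - (1 * g x y)) D HD Hsc) as [F HF].
  { exists (fun x y => - beta x y); intros x y Hxy.
    destruct (Hf x y Hxy) as [Hfx Hfy]; destruct (Hg x y Hxy) as [Hgx Hgy].
    refine (conj _ (conj _ (conj _ (conj _ _)))).
    - now apply Hcf.
    - apply continuity_2d_pt_ext with (fun x y => - g x y);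
        [intros; ring | now apply continuity_2d_pt_opp, Hcg].
    - now apply continuity_2d_pt_opp, Hc.
    - apply (is_derive_eq _ _ _ _ Hfy); ring.
    - apply is_derive_ext with (fun z => opp (g z y));
        [intros t; change (- g t y = - (1 * g t y)); ring|].
      apply (is_derive_opp (fun z => g z y)), Hgx. }
  destruct (closed_form_exact g (fun x y => 1 * f x y) D HD Hsc) as [G HG].
  { exists alpha; intros x y Hxy.
    destruct (Hf x y Hxy) as [Hfx Hfy]; destruct (Hg x y Hxy) as [Hgx Hgy].
    refine (conj _ (conj _ (conj _ (conj _ _)))).
    - now apply Hcg.
    - apply continuity_2d_pt_ext with f; [intros; ring | now apply Hcf].
    - now apply Hc.
    - apply (is_derive_eq _ _ _ _ Hgy); ring.
    - apply is_derive_ext with (fun z => f z y); 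
        [intros t; change (f t y = 1 * f t y); ring | exact Hfx]. }
  exists F, G; split; [exact HF|]; split; [exact HG|].
  intros x y Hxy; split; [now apply Hcf | now apply Hcg].
Qed.

(** * Difference quotients of Cauchy-Riemann pairs *)

(** The quotient is the real part of [(r1 + i r2) / (xi + i q eta)]. With [m] the larger of
    [Rabs xi] and [Rabs eta], its numerator is at most [e (1 + q) m^2] and its denominator at least
    [Rmin 1 (q^2) m^2]. *)
Lemma holomorphic_quotient_re q r1 r2 xi eta e :
  0 < q -> (xi <> 0 \/ eta <> 0) ->
  Rabs r1 <= e * Rmax (Rabs xi) (Rabs eta) ->
  Rabs r2 <= e * Rmax (Rabs xi) (Rabs eta) ->
  Rabs ((r1 * xi + r2 * (q * eta)) / (xi ^ 2 + q ^ 2 * eta ^ 2)) <=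
  e * (1 + q) / Rmin 1 (q ^ 2).
Proof.
  intros Hq Hne H1 H2.
  set (m := Rmax (Rabs xi) (Rabs eta)) in *.
  assert (Hxm : Rabs xi <= m) by apply Rmax_l.
  assert (Hem : Rabs eta <= m) by apply Rmax_r.
  pose proof (Rabs_pos xi); pose proof (Rabs_pos eta).
  assert (Hm : 0 < m).
  { destruct Hne as [Hx|Hx]; apply Rabs_pos_lt in Hx; lra. }
  assert (Hc : 0 < Rmin 1 (q ^ 2)) by (apply Rmin_pos; nra).
  pose proof (Rmin_l 1 (q ^ 2)); pose proof (Rmin_r 1 (q ^ 2)).
  set (c := Rmin 1 (q ^ 2)) in *.
  assert (Hx2 : xi ^ 2 = Rabs xi ^ 2) by (symmetry; apply pow2_abs).
  assert (He2 : eta ^ 2 = Rabs eta ^ 2) by (symmetry; apply pow2_abs).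
  assert (Hdn : c * m ^ 2 <= xi ^ 2 + q ^ 2 * eta ^ 2).
  { rewrite Hx2, He2.
    assert (0 <= Rabs xi ^ 2) by (apply pow_le; lra).
    assert (0 <= Rabs eta ^ 2) by (apply pow_le; lra).
    assert (m ^ 2 <= Rabs xi ^ 2 + Rabs eta ^ 2).
    { unfold m, Rmax; destruct Rle_dec; lra. }
    assert (c * m ^ 2 <= c * (Rabs xi ^ 2 + Rabs eta ^ 2))
      by (apply Rmult_le_compat_l; lra).
    assert (c * Rabs xi ^ 2 <= 1 * Rabs xi ^ 2)
      by (apply Rmult_le_compat_r; lra).
    assert (c * Rabs eta ^ 2 <= q ^ 2 * Rabs eta ^ 2)
      by (apply Rmult_le_compat_r; lra).
    lra. }
  assert (Hm2 : 0 < m ^ 2) by (apply pow_lt; lra).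
  assert (Hcm : 0 < c * m ^ 2) by (apply Rmult_lt_0_compat; lra).
  unfold Rdiv; rewrite Rabs_mult, Rabs_inv.
  rewrite (Rabs_pos_eq (xi ^ 2 + q ^ 2 * eta ^ 2)) by lra.
  apply Rle_div_l; [lra|].
  apply Rle_trans with (e * (1 + q) * m ^ 2).
  - apply Rle_trans with (1 := Rabs_triang _ _).
    rewrite !Rabs_mult, (Rabs_pos_eq q) by lra.
    assert (Rabs r1 * Rabs xi <= (e * m) * m)
      by (apply Rmult_le_compat; auto using Rabs_pos).
    assert (Rabs r2 * Rabs eta <= (e * m) * m)
      by (apply Rmult_le_compat; auto using Rabs_pos).
    assert (q * (Rabs r2 * Rabs eta) <= q * ((e * m) * m))
      by (apply Rmult_le_compat_l; lra).
    nra.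
  - assert (He : 0 <= e * (1 + q)).
    { assert (0 <= e) by (pose proof (Rabs_pos r1); nra). nra. }
    apply Rle_trans with (e * (1 + q) * / c * (c * m ^ 2)).
    + right; field; lra.
    + apply Rmult_le_compat_l; [|exact Hdn].
      apply Rmult_le_pos; [exact He | left; now apply Rinv_0_lt_compat].
Qed.

(** Together with [quot_im], the quotient of the increment of [f + i g] by [xi + i q eta], expanded
    with the conjugate of the denominator. *)
Definition quot_re (q : R) (f g : R -> R -> R) (x y xi eta : R) : R :=
  ((f (x + xi) (y + eta) - f x y) * xi +
   (g (x + xi) (y + eta) - g x y) * (q * eta)) / (xi ^ 2 + q ^ 2 * eta ^ 2).

Definition quot_im (q : R) (f g : R -> R -> R) (x y xi eta : R) : R :=
  ((g (x + xi) (y + eta) - g x y) * xi -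
   (f (x + xi) (y + eta) - f x y) * (q * eta)) / (xi ^ 2 + q ^ 2 * eta ^ 2).

Lemma holomorphic_quotient q (D : R * R -> Prop) f g alpha beta x y eps :
  0 < q -> open D -> cauchy_riemann q D f g alpha beta -> D (x, y) -> 0 < eps ->
  exists d, 0 < d /\ forall xi eta, Rabs xi < d -> Rabs eta < d ->
    xi <> 0 \/ eta <> 0 ->
    Rabs (quot_re q f g x y xi eta - alpha x y) < eps /\
    Rabs (quot_im q f g x y xi eta - beta x y) < eps.
Proof.
  intros Hq HD (Hf & Hg & Hc) Hxy Heps.
  destruct (Hc x y Hxy) as [Ha Hb].
  pose proof (gradient_on_differentiable D f _ _ x y HD Hf Hxy Ha) as Df.
  pose proof (gradient_on_differentiable D g _ _ x y HD Hg Hxy Hb) as Dg.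
  simpl in Df, Dg.
  assert (Hmin : 0 < Rmin 1 (q ^ 2)) by (apply Rmin_pos; nra).
  set (c := Rmin 1 (q ^ 2)) in *.
  (* This tolerance turns the bound of [holomorphic_quotient_re] into [eps / 2]. *)
  assert (He : 0 < eps * c / (2 * (1 + q))).
  { apply Rdiv_lt_0_compat; [apply Rmult_lt_0_compat; lra | lra]. }
  set (e := eps * c / (2 * (1 + q))) in *.
  destruct (Df (mkposreal e He)) as [d1 H1].
  destruct (Dg (mkposreal e He)) as [d2 H2]; simpl in H1, H2.
  exists (Rmin d1 d2); split; [apply Rmin_pos; apply cond_pos|].
  intros xi eta Hxi Heta Hne.
  pose proof (Rmin_l d1 d2); pose proof (Rmin_r d1 d2).
  specialize (H1 (x + xi) (y + eta)); specialize (H2 (x + xi) (y + eta)).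
  replace (x + xi - x) with xi in H1, H2 by ring.
  replace (y + eta - y) with eta in H1, H2 by ring.
  specialize (H1 ltac:(lra) ltac:(lra)); specialize (H2 ltac:(lra) ltac:(lra)).
  assert (Hdn : xi ^ 2 + q ^ 2 * eta ^ 2 <> 0).
  { assert (0 < q ^ 2) by (apply pow_lt; lra).
    pose proof (pow2_ge_0 xi); pose proof (pow2_ge_0 eta).
    destruct Hne as [Hx|Hx]; apply pow2_gt_0 in Hx; nra. }
  assert (Hlt : e * (1 + q) / c < eps).
  { unfold e; replace (eps * c / (2 * (1 + q)) * (1 + q) / c) with (eps / 2)
      by (field; lra); lra. }
  set (a := alpha x y) in *; set (b := beta x y) in *.
  set (r1 := f (x + xi) (y + eta) - f x y - (a * xi + - (q * b) * eta)) in *.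
  set (r2 := g (x + xi) (y + eta) - g x y - (b * xi + q * a * eta)) in *.
  split.
  - replace (quot_re q f g x y xi eta - a) with
      ((r1 * xi + r2 * (q * eta)) / (xi ^ 2 + q ^ 2 * eta ^ 2))
      by (unfold quot_re, r1, r2; field; rewrite ?Rpow_mult_distr; exact Hdn).
    apply Rle_lt_trans with (2 := Hlt).
    now apply holomorphic_quotient_re.
  (* An imaginary part is the real part after multiplication by [- i], which sends [(r1, r2)] to
     [(r2, - r1)]. *)
  - replace (quot_im q f g x y xi eta - b) with
      ((r2 * xi + (- r1) * (q * eta)) / (xi ^ 2 + q ^ 2 * eta ^ 2))
      by (unfold quot_im, r1, r2; field; rewrite ?Rpow_mult_distr; exact Hdn).
    apply Rle_lt_trans with (2 := Hlt).
    apply holomorphic_quotient_re; trivial; now rewrite Rabs_Ropp.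
Qed.

(** [w1 I1 + w2 I2] with [w1 = f1 + i g1] and [w2 = f2 + i g2]. *)
Definition B0_of_idempotent (f1 g1 f2 g2 : R) : B0 :=
  (((f1 + f2) / 2, (g1 + g2) / 2), ((f1 - f2) / 2, (g1 - g2) / 2)).

Definition xcoord (w : B0) : R := fst (fst w).
(** The [B0omega] coefficient of [zeta p x y] is [i (1 - p) y / 2]. *)
Definition ycoord (p : R) (w : B0) : R := 2 * snd (snd w) / (1 - p).

Definition B0_function (p : R) (f1 g1 f2 g2 : R -> R -> R) (w : B0) : B0 :=
  let x := xcoord w in let y := ycoord p w in
  B0_of_idempotent (f1 x y) (g1 x y) (f2 x y) (g2 x y).

Lemma xcoord_zeta p x y : xcoord (zeta p x y) = x.
Proof. unfold xcoord; b0_unfold; field. Qed.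

Lemma ycoord_zeta p x y : p <> 1 -> ycoord p (zeta p x y) = y.
Proof. intros Hp; unfold ycoord; b0_unfold; field; lra. Qed.

Lemma zeta_plus p x y xi eta :
  plus (zeta p x y) (zeta p xi eta) = zeta p (x + xi) (y + eta).
Proof. apply B0_eq; b0_unfold; field. Qed.

Lemma B0_function_zeta p f1 g1 f2 g2 x y :
  p <> 1 -> B0_function p f1 g1 f2 g2 (zeta p x y) =
  B0_of_idempotent (f1 x y) (g1 x y) (f2 x y) (g2 x y).
Proof.
  intros Hp; unfold B0_function; now rewrite xcoord_zeta, ycoord_zeta.
Qed.

(** Multiplication is componentwise in the idempotent basis, where [zeta p xi eta] has components
    [xi + i eta] and [xi + i p eta]. So the increment is the right-hand side times [zeta p xi eta],
    which is invertible. *)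
Lemma B0_function_quotient p f1 g1 f2 g2 x y xi eta :
  0 < p -> p <> 1 -> xi <> 0 \/ eta <> 0 -> zeta p xi eta <> zero ->
  B0mul (minus (B0_function p f1 g1 f2 g2 (plus (zeta p x y) (zeta p xi eta)))
               (B0_function p f1 g1 f2 g2 (zeta p x y)))
        (B0inv (zeta p xi eta)) =
  B0_of_idempotent (quot_re 1 f1 g1 x y xi eta) (quot_im 1 f1 g1 x y xi eta)
                   (quot_re p f2 g2 x y xi eta) (quot_im p f2 g2 x y xi eta).
Proof.
  intros Hp Hp1 Hne Hz.
  set (E := B0_of_idempotent (quot_re 1 _ _ _ _ _ _) _ _ _).
  rewrite zeta_plus, !B0_function_zeta by assumption.
  match goal with |- B0mul ?d _ = _ =>
    assert (Hd : d = B0mul E (zeta p xi eta)) end.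
  { assert (H1 : xi ^ 2 + 1 ^ 2 * eta ^ 2 <> 0).
    { pose proof (pow2_ge_0 xi); pose proof (pow2_ge_0 eta).
      destruct Hne as [Hx|Hx]; apply pow2_gt_0 in Hx; nra. }
    assert (H2 : xi ^ 2 + p ^ 2 * eta ^ 2 <> 0).
    { assert (0 < p ^ 2) by (apply pow_lt; lra).
      pose proof (pow2_ge_0 xi); pose proof (pow2_ge_0 eta).
      destruct Hne as [Hx|Hx]; apply pow2_gt_0 in Hx; nra. }
    unfold E, B0_of_idempotent, quot_re, quot_im.
    set (F1 := f1 (x + xi) _); set (G1 := g1 (x + xi) _).
    set (F2 := f2 (x + xi) _); set (G2 := g2 (x + xi) _).
    set (u1 := f1 x y); set (v1 := g1 x y); set (u2 := f2 x y); set (v2 := g2 x y).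
    clearbody F1 G1 F2 G2 u1 v1 u2 v2.
    apply B0_eq; b0_unfold; field; split; lra. }
  rewrite Hd, <- B0mul_assoc, (mu_invertible p); trivial.
  - now rewrite B0mul_comm, B0mul_e.
  - now exists xi, eta.
Qed.

Lemma B0_of_idempotent_ball a1 b1 a2 b2 c1 d1 c2 d2 (eps : posreal) :
  Rabs (c1 - a1) < eps -> Rabs (d1 - b1) < eps ->
  Rabs (c2 - a2) < eps -> Rabs (d2 - b2) < eps ->
  ball (B0_of_idempotent a1 b1 a2 b2) eps (B0_of_idempotent c1 d1 c2 d2).
Proof.
  intros H1 H2 H3 H4.
  apply Rabs_def2 in H1; apply Rabs_def2 in H2.
  apply Rabs_def2 in H3; apply Rabs_def2 in H4.
  split; split;
    match goal with |- ball ?a ?e ?b => change (Rabs (b - a) < e) end;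
    simpl; apply Rabs_def1; lra.
Qed.

Lemma cauchy_riemann_monogenic p (D : R * R -> Prop)
    f1 g1 a1 b1 f2 g2 a2 b2 :
  0 < p -> p <> 1 -> open D ->
  cauchy_riemann 1 D f1 g1 a1 b1 -> cauchy_riemann p D f2 g2 a2 b2 ->
  monogenic p D (B0_function p f1 g1 f2 g2).
Proof.
  intros Hp Hp1 HD H1 H2 z (x & y & Hxy & ->).
  exists (B0_of_idempotent (a1 x y) (b1 x y) (a2 x y) (b2 x y)).
  apply filterlim_locally; intros eps.
  destruct (holomorphic_quotient 1 D f1 g1 a1 b1 x y eps Rlt_0_1 HD H1 Hxy
    (cond_pos eps)) as (d1 & Hd1 & Q1).
  destruct (holomorphic_quotient p D f2 g2 a2 b2 x y eps Hp HD H2 Hxy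
    (cond_pos eps)) as (d2 & Hd2 & Q2).
  assert (Hd : 0 < Rmin d1 d2) by (apply Rmin_pos; assumption).
  set (d := Rmin d1 d2) in *.
  assert (Hdd : d <= d1 /\ d <= d2) by (split; [apply Rmin_l | apply Rmin_r]).
  assert (Hp1' : 0 < Rabs (1 - p)) by (apply Rabs_pos_lt; lra).
  (* The second bound serves [eta], which is seen only through the [B0omega] coefficient
     [i (1 - p) eta / 2]. *)
  assert (He : 0 < Rmin d (d * Rabs (1 - p) / 2)).
  { apply Rmin_pos; [exact Hd|].
    apply Rdiv_lt_0_compat; [apply Rmult_lt_0_compat; lra | lra]. }
  exists (mkposreal _ He); intros h Hh [(xi & eta & ->) Hz]; simpl in Hh.
  destruct Hh as [[Hx _] [_ Hy]].
  pose proof (Rmin_l d (d * Rabs (1 - p) / 2)).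
  pose proof (Rmin_r d (d * Rabs (1 - p) / 2)).
  assert (Hxi : Rabs xi < d).
  { apply Rlt_le_trans with (2 := H).
    apply Rle_lt_trans with (2 := Hx); right.
    change (Rabs xi = Rabs (fst (fst (zeta p xi eta)) - 0)).
    f_equal; change (xi = xcoord (zeta p xi eta) - 0).
    rewrite xcoord_zeta; ring. }
  assert (Heta : Rabs eta < d).
  { assert (E : Rabs (1 - p) * Rabs eta / 2 < d * Rabs (1 - p) / 2).
    { apply Rlt_le_trans with (2 := H0).
      apply Rle_lt_trans with (2 := Hy); right.
      change (Rabs (1 - p) * Rabs eta / 2 =
              Rabs (snd (snd (zeta p xi eta)) - 0)).
      rewrite <- (ycoord_zeta p xi eta Hp1) at 1; unfold ycoord.
      set (s := snd (snd (zeta p xi eta))).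
      rewrite <- Rabs_mult.
      replace ((1 - p) * (2 * s / (1 - p))) with (2 * s) by (field; lra).
      rewrite Rabs_mult, (Rabs_pos_eq 2), Rminus_0_r by lra; field. }
    apply Rmult_lt_reg_l with (Rabs (1 - p)); lra. }
  assert (Hne : xi <> 0 \/ eta <> 0).
  { destruct (Req_dec xi 0) as [->|]; [right|now left].
    intros ->; apply Hz; apply B0_eq; b0_unfold; ring. }
  rewrite B0_function_quotient by assumption.
  destruct (Q1 xi eta) as [R1 R2]; try lra; trivial.
  destruct (Q2 xi eta) as [R3 R4]; try lra; trivial.
  now apply B0_of_idempotent_ball.
Qed.

(** * Partial derivatives of the solution and harmonic conjugates *)

(** [partial_derive] applies the y-derivatives first. A further x-derivative is thus merely
    outermost, whereas a further y-derivative must commute with those in x, which takes smoothness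
    in a neighbourhood. *)
Lemma partial_derive_gradient (D : R * R -> Prop) u N :
  open D -> (forall x y, D (x, y) -> ex_diff_n u N x y) ->
  forall m k, (m + k < N)%nat ->
  gradient_on D (partial_derive m k u) (partial_derive (S m) k u)
    (partial_derive m (S k) u).
Proof.
  intros HD Hu m k Hmk x y Hxy; split.
  - apply Derive_correct, ex_diff_n_ex_deriv_inf_1 with N; auto.
  - rewrite <- Derive_partial_derive.
    + apply Derive_correct, ex_diff_n_ex_deriv_inf_2 with N; auto.
    + apply locally_2d_impl with (2 := open_locally_2d D x y HD Hxy).
      apply locally_2d_forall; intros a b Hab.
      apply ex_diff_n_m with N; [lia | now apply Hu].
Qed.

Lemma partial_derive_continuity u N m k x y :
  ex_diff_n u N x y -> (m + k <= N)%nat ->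
  continuity_2d_pt (partial_derive m k u) x y.
Proof.
  intros Hu Hmk; pose proof (ex_diff_n_deriv N m k Hmk u x y Hu) as H.
  destruct (N - (m + k))%nat; apply H.
Qed.

(** Separate equations let [h], [U] and [V] have any convenient shape, and those for [U] and [V] may
    use facts valid only on [D], such as a differential equation. Taking [b = 0] gives scalar
    multiples. *)
Lemma gradient_on_comb (D : R * R -> Prop) a b f P Q g P' Q' h U V :
  gradient_on D f P Q -> gradient_on D g P' Q' ->
  (forall x y, h x y = a * f x y + b * g x y) ->
  (forall x y, D (x, y) -> U x y = a * P x y + b * P' x y) ->
  (forall x y, D (x, y) -> V x y = a * Q x y + b * Q' x y) ->
  gradient_on D h U V.
Proof.
  intros Hf Hg Hh HU HV x y Hxy.
  destruct (Hf x y Hxy) as [Hfx Hfy]; destruct (Hg x y Hxy) as [Hgx Hgy].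
  rewrite (HU x y Hxy), (HV x y Hxy); split.
  - apply is_derive_ext with (fun z => plus (scal a (f z y)) (scal b (g z y)));
      [intros t; symmetry; apply Hh|].
    apply (is_derive_plus (fun z => scal a (f z y)) (fun z => scal b (g z y)));
      now apply (is_derive_scal (fun z => _ z y)).
  - apply is_derive_ext with (fun z => plus (scal a (f x z)) (scal b (g x z)));
      [intros t; symmetry; apply Hh|].
    apply (is_derive_plus (fun z => scal a (f x z)) (fun z => scal b (g x z)));
      now apply (is_derive_scal (fun z => _ x z)).
Qed.

Lemma continuity_2d_pt_comb a b f g x y :
  continuity_2d_pt f x y -> continuity_2d_pt g x y ->
  continuity_2d_pt (fun x y => a * f x y + b * g x y) x y.
Proof.
  intros Hf Hg; apply continuity_2d_pt_plus; apply continuity_2d_pt_mult;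
    trivial; apply continuity_2d_pt_const.
Qed.

(** The form [- fy / q dx + q fx dy] is closed because [- fyy / q = q fxx]; the conjugate is its
    potential. *)
Lemma harmonic_conjugate q (D : R * R -> Prop) f fx fy fxx fxy fyx fyy :
  0 < q -> open D -> simply_connected D ->
  gradient_on D f fx fy -> gradient_on D fx fxx fxy ->
  gradient_on D fy fyx fyy ->
  (forall x y, D (x, y) -> continuity_2d_pt fx x y /\
     continuity_2d_pt fy x y /\ continuity_2d_pt fxx x y) ->
  (forall x y, D (x, y) -> fyy x y + q ^ 2 * fxx x y = 0) ->
  exists g, cauchy_riemann q D f g fx (fun x y => - / q * fy x y).
Proof.
  intros Hq HD Hsc Hf Hfx Hfy Hc Heq.
  set (beta := fun x y => - / q * fy x y).
  assert (Hb : gradient_on D beta (fun x y => - / q * fyx x y)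
                                  (fun x y => q * fxx x y)).
  { apply (gradient_on_comb D (- / q) 0 fy fyx fyy fy fyx fyy); trivial.
    - intros; unfold beta; ring.
    - intros; ring.
    - intros x y Hxy; specialize (Heq x y Hxy).
      replace (fyy x y) with (- (q ^ 2 * fxx x y)) by lra; field; lra. }
  assert (Ha : gradient_on D (fun x y => q * fx x y) (fun x y => q * fxx x y)
                 (fun x y => q * fxy x y)).
  { apply (gradient_on_comb D q 0 fx fxx fxy fx fxx fxy); trivial; intros; ring. }
  assert (Hcb : forall x y, D (x, y) -> continuity_2d_pt beta x y).
  { intros x y Hxy; apply continuity_2d_pt_mult;
      [apply continuity_2d_pt_const | now apply Hc]. }
  destruct (closed_form_exact beta (fun x y => q * fx x y) D HD Hsc) as [g Hg].
  { exists (fun x y => q * fxx x y); intros x y Hxy.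
    refine (conj _ (conj _ (conj _ (conj _ _)))).
    - now apply Hcb.
    - apply continuity_2d_pt_mult; [apply continuity_2d_pt_const | now apply Hc].
    - apply continuity_2d_pt_mult; [apply continuity_2d_pt_const | now apply Hc].
    - apply (Hb x y Hxy).
    - apply (Ha x y Hxy). }
  exists g; split; [|split; [exact Hg|]].
  - apply (gradient_on_comb D 1 0 f fx fy f fx fy); trivial; intros;
      unfold beta; try ring; field; lra.
  - intros x y Hxy; split; [now apply Hc | now apply Hcb].
Qed.

Lemma cauchy_riemann_scal c q (D : R * R -> Prop) f g alpha beta :
  cauchy_riemann q D f g alpha beta ->
  cauchy_riemann q D (fun x y => c * f x y) (fun x y => c * g x y)
    (fun x y => c * alpha x y) (fun x y => c * beta x y).
Proof.
  intros (Hf & Hg & Hc); split; [|split].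
  - apply (gradient_on_comb D c 0 _ _ _ _ _ _ _ _ _ Hf Hf); intros; ring.
  - apply (gradient_on_comb D c 0 _ _ _ _ _ _ _ _ _ Hg Hg); intros; ring.
  - intros x y Hxy; split; (apply continuity_2d_pt_mult;
      [apply continuity_2d_pt_const | now apply Hc]).
Qed.

(** The element [c1 e1 + c2 e2] has idempotent components [w1 = c1 + i c2] and [w2 = c1 + i p c2],
    whence [c1 = (p w1 - w2) / (p - 1)]. *)
Lemma U1_B0_of_idempotent p f1 g1 f2 g2 :
  p <> 1 -> U1 p (B0_of_idempotent f1 g1 f2 g2) = (p * f1 - f2) / (p - 1).
Proof.
  intros Hp; unfold U1, B0_of_idempotent; b0_unfold; field; lra.
Qed.

Theorem mainTheorem2 (p : R) (hp : 0 < p) (hp1 : p <> 1)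
  (D : R * R -> Prop) (hD : plane_domain D) (hbd : plane_bounded D)
  (hsc : simply_connected D)
  (u : R -> R -> R) (hu : classical_solution p D u) :
  exists Phi : B0 -> B0,
    monogenic p D Phi /\
    forall x y : R, D (x, y) -> U1 p (Phi (zeta p x y)) = u x y.
Proof.
  destruct hD as [HD _].
  assert (Hp2 : p ^ 2 - 1 <> 0).
  { replace (p ^ 2 - 1) with ((p - 1) * (p + 1)) by ring.
    apply Rmult_integral_contrapositive; lra. }
  assert (Hgrad := partial_derive_gradient D u 4 HD
    (fun x y Hxy => proj1 (hu x y Hxy))).
  assert (Hcont : forall m k x y, (m + k <= 4)%nat -> D (x, y) ->
    continuity_2d_pt (partial_derive m k u) x y).
  { intros m k x y Hmk Hxy; apply partial_derive_continuity with 4%nat;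
      [apply (hu x y Hxy) | exact Hmk]. }
  (* [w m k] is the derivative of [v = u_yy + p^2 u_xx], [m] times in x and [k] times in y. *)
  set (w := fun m k x y => 1 * partial_derive m (2 + k) u x y
                           + p ^ 2 * partial_derive (2 + m) k u x y).
  assert (Hw : forall m k, (m + k < 2)%nat ->
    gradient_on D (w m k) (w (S m) k) (w m (S k))).
  { intros m k Hmk; eapply gradient_on_comb;
      [apply (Hgrad m (2 + k)%nat); lia | apply (Hgrad (2 + m)%nat k); lia | ..];
      reflexivity. }
  assert (Hwc : forall m k x y, (m + k <= 2)%nat -> D (x, y) ->
    continuity_2d_pt (w m k) x y).
  { intros m k x y Hmk Hxy; apply continuity_2d_pt_comb; apply Hcont;
      trivial; lia. }
  destruct (harmonic_conjugate 1 D (w 0 0)%nat (w 1 0)%nat (w 0 1)%nat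
    (w 2 0)%nat (w 1 1)%nat (w 1 1)%nat (w 0 2)%nat Rlt_0_1 HD hsc)
    as [k Hk]; try (apply Hw; lia).
  { intros x y Hxy; repeat split; apply Hwc; trivial; lia. }
  (* Harmonicity of [v] is the given equation, expanded. *)
  { intros x y Hxy; destruct (hu x y Hxy) as [_ E]; unfold w; simpl Nat.add.
    lra. }
  destruct (cauchy_riemann_primitive D _ _ _ _ HD hsc Hk) as (A & B & HAB).
  destruct (cauchy_riemann_primitive D _ _ _ _ HD hsc HAB) as (a & b & Hab).
  (* As [a_xx = v] and [a_yy = - v], the function [u + c a] satisfies the second-order equation
     exactly when [1 + (p^2 - 1) c = 0]. *)
  set (c := - / (p ^ 2 - 1)).
  destruct (harmonic_conjugate p D (fun x y => 1 * u x y + c * a x y)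
    (fun x y => 1 * partial_derive 1 0 u x y + c * A x y)
    (fun x y => 1 * partial_derive 0 1 u x y + - c * B x y)
    (fun x y => 1 * partial_derive 2 0 u x y + c * w 0%nat 0%nat x y)
    (fun x y => 1 * partial_derive 1 1 u x y + - c * k x y)
    (fun x y => 1 * partial_derive 1 1 u x y + - c * k x y)
    (fun x y => 1 * partial_derive 0 2 u x y + - c * w 0%nat 0%nat x y)
    hp HD hsc) as [g Hg].
  - apply (gradient_on_comb D 1 c _ _ _ _ _ _ _ _ _
      (Hgrad 0%nat 0%nat ltac:(lia)) (proj1 Hab)); intros; trivial; ring.
  - apply (gradient_on_comb D 1 c _ _ _ _ _ _ _ _ _
      (Hgrad 1%nat 0%nat ltac:(lia)) (proj1 HAB)); intros; trivial; ring.
  - apply (gradient_on_comb D 1 (- c) _ _ _ _ _ _ _ _ _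
      (Hgrad 0%nat 1%nat ltac:(lia)) (proj1 (proj2 HAB))); intros; trivial; ring.
  - intros x y Hxy; destruct (proj2 (proj2 Hab) x y Hxy) as [HA HB].
    repeat split; apply continuity_2d_pt_comb; trivial;
      try (apply Hcont; trivial; lia); apply Hwc; trivial; lia.
  - intros x y Hxy; unfold w, c; simpl Nat.add; field; exact Hp2.
  (* With [F1 = (a + i b) / (p (p + 1))], the term [p F1 / (p - 1)] has real part
     [a / (p^2 - 1) = - c a]. The factor [1 - p] in [F2] makes [- F2 / (p - 1)] contribute
     [u + c a], and the sum is [u]. *)
  - exists (B0_function p (fun x y => / (p * (p + 1)) * a x y)
      (fun x y => / (p * (p + 1)) * b x y)
      (fun x y => (1 - p) * (1 * u x y + c * a x y))
      (fun x y => (1 - p) * g x y)).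
    split.
    + apply (cauchy_riemann_monogenic p D _ _ _ _ _ _ _ _ hp hp1 HD
        (cauchy_riemann_scal _ _ _ _ _ _ _ Hab)
        (cauchy_riemann_scal _ _ _ _ _ _ _ Hg)).
    + intros x y Hxy; rewrite B0_function_zeta, U1_B0_of_idempotent by trivial.
      unfold c; field; repeat split; try lra; exact Hp2.
Qed.
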